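(* Let $R$ be a local ring of dimension one, and let $\zeta: 0\to M_1\to M\to M_2\to 0$ be an exact sequence of finitely generated $R$-modules such that $M$ is torsion-free and $M_1$ has finite injective dimension. If $\operatorname{tor}(M)\cong\operatorname{tor}(M_1)\oplus\operatorname{tor}(M_2)$, then $\zeta$ splits.
   Context: Rings are commutative and noetherian. For an $R$-module $L$, $\operatorname{tor}(L)$ denotes its torsion submodule, consisting of the elements annihilated by some non-zerodivisor of $R$; $L$ is torsion-free if $\operatorname{tor}(L)=0$. *)

(* Defs.v *)
From HB Require Import structures.
From mathcomp Require Import all_boot all_algebra.
From mathcomp Require Import boolp.

Set Implicit Arguments.
Unset Strict Implicit.
Unset Printing Implicit Defensive.

Import GRing.Theory.
Local Open Scope ring_scope.

(* Subsets are boolean predicates {pred T}. No generality is lost: by `asbool`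
   from boolp every Prop-valued predicate is reflected by a boolean one. *)

Section Rings.
Variable R : comNzRingType.

(* Ideals, possibly the unit ideal, are the submodules of R^o;
   [idealr_closed] of ring_quotient only covers proper ideals. *)
Definition ideal (I : {pred R^o}) : Prop := submod_closed I.

Definition noetherian : Prop :=
  forall I : {pred R^o}, ideal I ->
    exists (n : nat) (g : 'I_n -> R^o), forall x : R^o,
      x \in I <-> exists c : 'I_n -> R, x = \sum_(i < n) c i *: g i.

Definition maximal_ideal (m : {pred R}) : Prop :=
  idealr_closed m /\
  forall I : {pred R}, idealr_closed I -> {subset m <= I} -> {subset I <= m}.

Definition local_ring : Prop :=
  exists m : {pred R},
    maximal_ideal m /\ forall m' : {pred R}, maximal_ideal m' -> m' =i m.

Definition prime_ideal (P : {pred R}) : Prop :=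
  idealr_closed P /\ prime_idealr_closed P.

(* A strictly increasing chain p 0 < ... < p n has length n. *)
Definition prime_chain (n : nat) (p : 'I_n.+1 -> {pred R}) : Prop :=
  (forall i, prime_ideal (p i)) /\
  forall i j : 'I_n.+1, (i < j)%N ->
    {subset p i <= p j} /\ ~ {subset p j <= p i}.

Definition krull_dim_eq (d : nat) : Prop :=
  (exists p : 'I_d.+1 -> {pred R}, prime_chain p) /\
  forall (n : nat) (p : 'I_n.+1 -> {pred R}), prime_chain p -> (n <= d)%N.

(* R is commutative, so left regular elements are the non-zerodivisors. *)
Definition nonzerodivisor (r : R) : Prop := GRing.lreg r.

End Rings.

Section Torsion.
Variables (R : comNzRingType) (L : lmodType R).

Definition tor_pred : {pred L} :=
  fun x => `[< exists r : R, nonzerodivisor r /\ r *: x = 0 >].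

Fact tor_pred_submod_closed : submod_closed tor_pred.
Proof.
split=> [|a x y /asboolP[r [regr rx0]] /asboolP[s [regs sy0]]]; apply/asboolP.
  by exists 1; split; [exact: GRing.lreg1 | rewrite scaler0].
exists (r * s); split; first exact: GRing.lregM.
rewrite scalerDr -[(r * s) *: y]scalerA sy0 scaler0 addr0.
by rewrite scalerA -mulrA mulrC -scalerA rx0 scaler0.
Qed.

HB.instance Definition _ :=
  GRing.isSubmodClosed.Build R L tor_pred tor_pred_submod_closed.

Definition torsion_free : Prop := forall x : L, x \in tor_pred -> x = 0.

Definition tor : Type := {x : L | x \in tor_pred}.

HB.instance Definition _ := SubChoice.on tor.
HB.instance Definition _ := [SubChoice_isSubLmodule of tor by <:].

End Torsion.

Section Modules.
Variable R : comNzRingType.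

Definition finitely_generated (L : lmodType R) : Prop :=
  exists (n : nat) (g : 'I_n -> L), forall x : L,
    exists c : 'I_n -> R, x = \sum_(i < n) c i *: g i.

Definition isomorphic (A B : lmodType R) : Prop :=
  exists f : {linear A -> B}, bijective f.

Definition exact_at (A B C : lmodType R)
    (f : {linear A -> B}) (g : {linear B -> C}) : Prop :=
  forall y : B, g y = 0 <-> exists x : A, y = f x.

Definition short_exact (A B C : lmodType R)
    (f : {linear A -> B}) (g : {linear B -> C}) : Prop :=
  [/\ injective f, exact_at f g & forall z : C, exists y : B, z = g y].

Definition split_exact (A B C : lmodType R)
    (f : {linear A -> B}) (g : {linear B -> C}) : Prop :=
  short_exact f g /\ exists s : {linear C -> B}, cancel s g.

Definition injective_module (E : lmodType R) : Prop :=
  forall (A B : lmodType R) (i : {linear A -> B}) (f : {linear A -> E}),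
    injective i -> exists h : {linear B -> E}, forall x : A, h (i x) = f x.

(* A resolution 0 -> L -> I 0 -> I 1 -> ... by injectives that vanishes beyond
   some degree n. *)
Definition finite_injective_dimension (L : lmodType R) : Prop :=
  exists (n : nat) (I : nat -> lmodType R)
         (e : {linear L -> I 0%N}) (d : forall k : nat, {linear I k -> I k.+1}),
    [/\ forall k, injective_module (I k),
        injective e /\ exact_at e (d 0%N),
        forall k, exact_at (d k) (d k.+1)
      & forall k, (n < k)%N -> forall x : I k, x = 0].

End Modules.

(* Main.v *)
Require Import Defs.
From HB Require Import structures.
From mathcomp Require Import all_boot all_algebra.
From mathcomp Require Import boolp functions ring.

(* As M is torsion-free, so is M2. Descending induction on i, noetherian
   induction on J and Nakayama's lemma, applied to a finite injective
   resolution of M1, show that Ext^i(R/J, M1) = 0 for all ideals J and all i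
   > depth R: the only prime that needs an argument specific to the depth is
   the maximal ideal m, and m is the annihilator of an element of R (depth
   0) or of R/(r) with r regular in m (depth 1). In depth 0 this makes M1
   injective with respect to finitely generated modules. In depth 1 the
   vanishing of Ext^2 shows that r, which is regular on M2, acts
   surjectively on the finitely generated module Ext^1(M2, M1), which is
   therefore zero. *)

Set Implicit Arguments.
Unset Strict Implicit.
Unset Printing Implicit Defensive.

Import GRing.Theory.
Local Open Scope ring_scope.

(** * Submodules as predicates, spans and finite generation *)

Section Submodules.
Variable R : comNzRingType.

Definition submodule (L : lmodType R) (S : L -> Prop) : Prop :=
  S 0 /\ forall a x y, S x -> S y -> S (a *: x + y).

Section Basics.
Variables (L : lmodType R) (S : L -> Prop).
Hypothesis Ssub : submodule S.

Lemma submodule0 : S 0. Proof. by case: Ssub. Qed.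

Lemma submoduleZ a x : S x -> S (a *: x).
Proof. by case: Ssub => S0 SD Sx; rewrite -[_ *: _]addr0; apply: SD. Qed.

Lemma submoduleD x y : S x -> S y -> S (x + y).
Proof. by case: Ssub => _ SD Sx; rewrite -[x]scale1r; apply: SD. Qed.

Lemma submoduleB x y : S x -> S y -> S (x - y).
Proof. by move=> Sx Sy; rewrite -scaleN1r; apply/submoduleD/submoduleZ. Qed.

End Basics.

Lemma submodule_setT (L : lmodType R) : submodule (fun _ : L => True).
Proof. by []. Qed.

Lemma submodule_eq0 (L : lmodType R) : submodule (fun x : L => x = 0).
Proof. by split=> // a x y -> ->; rewrite scaler0 addr0. Qed.

Lemma submodule_preim (A B : lmodType R) (f : {linear A -> B}) (S : B -> Prop) :
  submodule S -> submodule (fun x => S (f x)).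
Proof. by case=> S0 SD; split=> [|a x y]; rewrite ?linear0 ?linearP //; apply: SD. Qed.

Lemma submodule_adjoin (L : lmodType R) (S : L -> Prop) (b : L) :
  submodule S -> submodule (fun x => exists c : R, S (x - c *: b)).
Proof.
move=> [S0 SD]; split=> [|a x y [c Sx] [c' Sy]].
  by exists 0; rewrite scale0r subr0.
exists (a * c + c'); have -> : a *: x + y - (a * c + c') *: b
    = a *: (x - c *: b) + (y - c' *: b); last exact: SD.
by rewrite scalerDl scalerBr scalerA opprD addrACA.
Qed.

Section Span.
Variable L : lmodType R.

(** The recursion splits off one generator at a time, which is the form that the inductions on the
    number of generators need. *)
Fixpoint in_span (s : seq L) (x : L) : Prop :=
  if s is g :: s' then exists c : R, in_span s' (x - c *: g) else x = 0.

Lemma in_span_submodule s : submodule (in_span s).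
Proof. by elim: s => [|g s IH]; [exact: submodule_eq0 | exact: submodule_adjoin]. Qed.

Lemma in_span_sub (S : L -> Prop) s : submodule S ->
  (forall g, g \in s -> S g) -> forall x, in_span s x -> S x.
Proof.
move=> Ssub; elim: s => [_ x /= ->|g s IH Ss x /= [c /IH Sx]]; first exact: submodule0.
rewrite -(subrK (c *: g) x); apply: (submoduleD Ssub).
  by apply: Sx => h hs; apply: Ss; rewrite inE hs orbT.
by apply: submoduleZ => //; apply: Ss; rewrite mem_head.
Qed.

Lemma in_span_cons g s x : in_span s x -> in_span (g :: s) x.
Proof. by rewrite /=; exists 0; rewrite scale0r subr0. Qed.

Lemma mem_in_span s g : g \in s -> in_span s g.
Proof.
elim: s => // h s IH; rewrite inE => /predU1P[-> /=|/IH]; last exact: in_span_cons.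
by exists 1; rewrite scale1r subrr; exact: (submodule0 (in_span_submodule s)).
Qed.

Lemma in_span_cat s t x y : in_span s x -> in_span t y -> in_span (s ++ t) (x + y).
Proof.
elim: s x => [x -> //=|g s IH x /= [c /IH sx] ty]; first by rewrite add0r.
by exists c; rewrite addrAC; apply: sx.
Qed.

Definition fgen (C : L -> Prop) : Prop :=
  exists2 s : seq L, forall g, g \in s -> C g & forall x, C x -> in_span s x.

Lemma in_span_sum n (g : 'I_n -> L) (c : 'I_n -> R) :
  in_span [seq g i | i <- enum 'I_n] (\sum_(i < n) c i *: g i).
Proof.
apply: (@big_ind _ (in_span _)); first exact: (submodule0 (in_span_submodule _)).
  by move=> x y; apply: (submoduleD (in_span_submodule _)).
move=> i _; apply: submoduleZ; first exact: in_span_submodule.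
by apply/mem_in_span/map_f; rewrite mem_enum.
Qed.

End Span.

Lemma fgenT (L : lmodType R) : finitely_generated L -> fgen (fun _ : L => True).
Proof.
move=> [n [g gP]]; exists [seq g i | i <- enum 'I_n] => // x _.
by have [c ->] := gP x; apply: in_span_sum.
Qed.

Lemma fgen_ideal (I : R^o -> Prop) : noetherian R -> submodule I -> fgen I.
Proof.
move=> Rnoeth [I0 ID].
have [|n [g gP]] := Rnoeth (fun x : R^o => `[< I x >]).
  split=> [|a x y /asboolP Ix /asboolP Iy]; first exact/asboolP.
  by apply/asboolP/ID.
exists [seq g i | i <- enum 'I_n] => [h /mapP[i _ ->]|x Ix].
  suff /asboolP : g i \in (fun x : R^o => `[< I x >]) by [].
  apply/gP; exists (fun j => (i == j)%:R); rewrite (bigD1 i) //= eqxx scale1r.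
  by rewrite big1 ?addr0 // => j /negPf; rewrite eq_sym => ->; rewrite scale0r.
have [|c ->] := (gP x).1; [exact/asboolP | exact: in_span_sum].
Qed.

(* A linear relation transports generators: [Q] is used to keep track of the
   set in which the images are chosen. *)
Lemma in_span_rel (U V : lmodType R) (T : U -> V -> Prop) (Q : V -> Prop) (s : seq U) :
    T 0 0 -> (forall a u v u' v', T u v -> T u' v' -> T (a *: u + u') (a *: v + v')) ->
    (forall u, u \in s -> exists2 v, T u v & Q v) ->
  exists2 s', forall v, v \in s' -> Q v &
    forall u, in_span s u -> exists2 v, in_span s' v & T u v.
Proof.
move=> T0 TD; elim: s => [_|g s IH Hs].
  by exists [::] => // u /= ->; exists 0.
have [h|s' s'Q Hs'] := IH; first by move=> hs; apply: Hs; rewrite inE hs orbT.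
have [|v Tgv Qv] := Hs g; first exact: mem_head.
exists (v :: s') => [w|u /= [c /Hs'[w sw Tw]]].
  by rewrite inE => /predU1P[->|/s'Q].
exists (c *: v + w); first by exists c; rewrite addrAC subrr add0r.
by rewrite -(subrK (c *: g) u) addrC; apply: TD.
Qed.

(** An extension of finitely generated modules is finitely generated: lifts of generators of the
    image, together with generators of the kernel, generate [C]. Since [T] is a linear relation,
    multivalued maps are allowed. *)
Lemma fgen_ext (U V : lmodType R) (T : U -> V -> Prop) (C : U -> Prop) :
    submodule C ->
    T 0 0 -> (forall a u v u' v', T u v -> T u' v' -> T (a *: u + u') (a *: v + v')) ->
    (forall u, C u -> exists v, T u v) ->
    fgen (fun v => exists2 u, C u & T u v) ->
    fgen (fun u => C u /\ T u 0) ->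
  fgen C.
Proof.
move=> Csub T0 TD Ttot [s sC sS] [t tC tS].
have [||s' s'C s'S] := @in_span_rel V U (fun v u => T u v) C s T0.
- by move=> a u v u' v'; apply: TD.
- by move=> v /sC[u Cu Tuv]; exists u.
have subC u : in_span s' u -> C u by apply: in_span_sub.
exists (s' ++ t) => [g|x Cx].
  by rewrite mem_cat => /orP[/s'C|/tC[]].
have [v Txv] := Ttot x Cx; have [|u su Tuv] := s'S v.
  by apply: sS; exists x.
rewrite -(subrK u x) addrC; apply: in_span_cat => //; apply: tS; split.
  exact: (submoduleB Csub Cx (subC _ su)).
have := TD (-1) _ _ _ _ Tuv Txv; rewrite !scaleN1r addrC.
by rewrite [- v + v]addNr.
Qed.

(** Induction on the number of generators. The coefficient of the first generator is determined only
    modulo the relations, so it is a relation from [C] to [R]; its image is an ideal and its kernel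
    lies in the span of the other generators. *)
Lemma fgen_sub (L : lmodType R) (C : L -> Prop) :
  noetherian R -> finitely_generated L -> submodule C -> fgen C.
Proof.
move=> Rnoeth /fgenT[s _ sS] Csub.
have {sS} : forall x, C x -> in_span s x by move=> x _; apply: sS.
elim: s C Csub => [|g s IH] C Csub Cs.
  by exists [::].
have spanP : submodule (in_span s) by apply: in_span_submodule.
have spanlin a x (r : R^o) y r' : in_span s (x - r *: g) -> in_span s (y - r' *: g) ->
    in_span s (a *: x + y - (a *: r + r') *: g).
  move=> sx sy; have -> : a *: x + y - (a *: r + r') *: g
      = a *: (x - r *: g) + (y - r' *: g); last exact: spanP.2.
  by rewrite scalerDl scalerBr -scalerA opprD addrACA.
apply: (@fgen_ext L R^o (fun x r => in_span s (x - r *: g))) => //.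
- by rewrite scale0r subr0; apply: submodule0.
- apply: fgen_ideal => //; split=> [|a x y [u Cu su] [v Cv sv]].
    exists 0; first exact: submodule0.
    by rewrite scale0r subr0; apply: submodule0.
  by exists (a *: u + v); [apply: Csub.2 | apply: spanlin].
- apply: IH => [|x [_]]; last by rewrite scale0r subr0.
  split=> [|a x y [Cx sx] [Cy sy]].
    by split; [exact: submodule0 | rewrite scale0r subr0; exact: submodule0].
  move: sx sy; rewrite !scale0r !subr0 => sx sy.
  by split; [apply: Csub.2 | apply: spanP.2].
Qed.

End Submodules.

(** * Maximal elements and prime ideals in noetherian rings *)

Section NoetherianRing.
Variable R : comNzRingType.
Hypothesis Rnoeth : noetherian R.

Implicit Types (I J P : R^o -> Prop) (r s x y : R).

(** Otherwise a choice function gives a strictly ascending sequence of ideals; the finitely many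
    generators of its union already lie in one stage. The ideals are indexed by [T] so that the
    maximum also yields the element or exponent defining the ideal. *)
Lemma noeth_max (T : Type) (Q : T -> Prop) (J : T -> R^o -> Prop) :
    (exists t, Q t) -> (forall t, Q t -> submodule (J t)) ->
  exists2 t, Q t &
    forall t', Q t' -> (forall x, J t x -> J t' x) -> forall x, J t' x -> J t x.
Proof.
move=> [t0 Qt0] Jsub; apply: contrapT => nomax.
have step (t : T) : exists t', Q t ->
    [/\ Q t', forall x, J t x -> J t' x & exists2 x, J t' x & ~ J t x].
  apply: contrapT => H; have Qt : Q t.
    by apply: contrapT => nQ; apply: H; exists t => /nQ.
  apply: nomax; exists t => // t' Qt' tt' x J'x; apply: contrapT => nJx.
  by apply: H; exists t' => _; split => //; exists x.
have [f fP] := choice step.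
have Qn n : Q (iter n f t0) by elim: n => //= n /fP[].
have mono n k x : J (iter n f t0) x -> J (iter (k + n) f t0) x.
  by elim: k => //= k IH Jx; case: (fP _ (Qn (k + n))) => _ + _; apply; apply: IH.
have Usub : submodule (fun x : R^o => exists n, J (iter n f t0) x).
  split=> [|a x y [n Jx] [k Jy]]; first by exists 0%N; exact: (submodule0 (Jsub _ Qt0)).
  exists (n + k)%N; apply: (Jsub _ (Qn _)).2; last exact: mono.
  by rewrite addnC; apply: mono.
have [s sU sS] := fgen_ideal Rnoeth Usub.
have [N sN] : exists N, forall g, g \in s -> J (iter N f t0) g.
  elim: s sU {sS} => [|g s IH] sU; first by exists 0%N.
  have [|N sN] := IH; first by move=> h hs; apply: sU; rewrite inE hs orbT.
  have [|n Jg] := sU g; first exact: mem_head.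
  exists (N + n)%N => h; rewrite inE => /predU1P[->|hs]; first exact: mono.
  by rewrite addnC; apply: mono; apply: sN.
have [_ _ [x Jx nJx]] := fP _ (Qn N).
by apply: nJx; apply: (in_span_sub (Jsub _ (Qn N)) sN); apply: sS; exists N.+1.
Qed.

Definition prime P : Prop :=
  [/\ submodule P, ~ P 1 & forall x y, P (x * y) -> P x \/ P y].

Lemma prime_expr P x n : prime P -> P (x ^+ n) -> P x.
Proof.
case=> _ P1 Pp; elim: n => [|n IH]; first by rewrite expr0.
by rewrite exprS => /Pp[].
Qed.

(** An ideal maximal among those that contain [I] and miss [T] is prime: if neither [x] nor [y] is
    in [P], both [P + (x)] and [P + (y)] meet [T], and the product of the two elements found lies in
    [P] when [x * y] does. *)
Lemma exists_prime_avoiding (T : R -> Prop) (I : R^o -> Prop) :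
    T 1 -> (forall x y, T x -> T y -> T (x * y)) ->
    submodule I -> (forall x, I x -> ~ T x) ->
  exists P, [/\ prime P, forall x, I x -> P x & forall x, P x -> ~ T x].
Proof.
move=> T1 TM Isub IT.
pose Q J := [/\ submodule J, forall x, I x -> J x & forall x, J x -> ~ T x].
have [||P [Psub IP PT] Pmax] := @noeth_max _ Q (fun J => J).
- by exists I.
- by move=> J [].
exists P; split=> //; split=> // [/PT//|x y Pxy].
have meets z : ~ P z -> exists t c : R, T t /\ P (t - c * z).
  move=> nPz; apply: contrapT => H; apply: nPz.
  apply: (Pmax (fun u => exists c : R, P (u - c *: (z : R^o)))).
  - split=> [|u Iu|u [c Pu] Tu]; first exact: submodule_adjoin.
      by exists 0; rewrite scale0r subr0; apply: IP.
    by apply: H; exists u, c.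
  - by move=> u Pu; exists 0; rewrite scale0r subr0.
  - by exists 1; rewrite scale1r subrr; apply: (submodule0 Psub).
have [Px|/meets[t [c [Tt Pt]]]] := pselect (P x); first by left.
have [Py|/meets[u [c' [Tu Pu]]]] := pselect (P y); first by right.
case: (PT (t * u)); last exact: TM.
have -> : t * u = u * (t - c * x) + ((c * x) * (u - c' * y) + (c * c') * (x * y)) by ring.
apply: (Psub.2); first exact: Pt.
by apply: (Psub.2); [exact: Pu|apply: (submoduleZ Psub)].
Qed.

End NoetherianRing.

Lemma principal_submodule (R : comNzRingType) (x : R) : submodule (fun y : R^o => exists c : R, y = c * x).
Proof.
split=> [|a y z [c ->] [c' ->]]; first by exists 0; rewrite mul0r.
by exists (a * c + c'); rewrite mulrDl -mulrA.
Qed.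

(** * Noetherian local rings and socles in dimension one *)

Section LocalRing.
Variable R : comNzRingType.
Hypothesis Rnoeth : noetherian R.

(** By noetherianity a proper ideal lies in a maximal one, which is [m] by uniqueness. *)
Lemma local_ringP : local_ring R -> exists m : R^o -> Prop,
  [/\ submodule m, ~ m 1 &
      forall I : R^o -> Prop, submodule I -> ~ I 1 -> forall x, I x -> m x].
Proof.
have closedP (J : {pred R}) :
    idealr_closed J <-> submodule (fun x : R^o => x \in J) /\ 1 \notin J.
  split=> [[J0 J1 JD]|[[J0 JD] J1]].
    by split=> //; split=> // a x y Jx Jy; apply: JD.
  by split=> // a x y Jx Jy; apply: JD.
case=> m [[/closedP[msub m1] mmax] muniq].
exists (fun x => x \in m); split=> //; first exact/negP.
move=> I Isub I1.
pose Q (J : R^o -> Prop) := [/\ submodule J, forall x, I x -> J x & ~ J 1].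
have [||J [Jsub IJ J1] Jmax] := @noeth_max _ Rnoeth _ Q (fun J => J).
- by exists I.
- by move=> J [].
suff Jm : maximal_ideal (fun x : R => `[< J x >]).
  by move=> x /IJ Jx; rewrite -(muniq _ Jm x); apply/asboolP.
have Jid : submodule (fun x : R^o => x \in (fun x : R => `[< J x >])).
  split; first by apply/asboolP; case: Jsub.
  by move=> a x y /asboolP Jx /asboolP Jy; apply/asboolP; apply: Jsub.2.
split; first by apply/closedP; split=> //; apply/negP => /asboolP.
move=> K /closedP[Ksub K1] JK x Kx; apply/asboolP.
apply: (Jmax (fun x => x \in K)) => //; last by move=> y Jy; apply: JK; apply/asboolP.
by split=> //; [move=> y /IJ Jy; apply: JK; apply/asboolP | exact/negP].
Qed.

Variable m : R^o -> Prop.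
Hypotheses (msub : submodule m) (m1 : ~ m 1).
Hypothesis mmax : forall I : R^o -> Prop, submodule I -> ~ I 1 -> forall x, I x -> m x.

Lemma unit_notin (x : R) : ~ m x -> exists v : R, v * x = 1.
Proof.
move=> nmx; apply: contrapT => nu; apply: nmx.
apply: (mmax (principal_submodule x)).
- by case=> c e; apply: nu; exists c.
- by exists 1; rewrite mul1r.
Qed.

Lemma unit_1B (x : R) : m x -> exists v : R, v * (1 - x) = 1.
Proof.
move=> mx; apply: unit_notin => m1x; apply: m1.
by rewrite -(subrK x 1); apply: (submoduleD msub).
Qed.

Lemma prime_local (P : R^o -> Prop) : prime P -> forall x, P x -> m x.
Proof. by case=> Psub P1 _; apply: mmax. Qed.

Lemma local_prime : prime m.
Proof.
split=> // x y mxy; have [mx|/unit_notin[v vx]] := pselect (m x); first by left.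
by right; rewrite -[y]mul1r -vx -mulrA; apply: (submoduleZ msub).
Qed.

(* The hypothesis on [U] says that [m] acts locally nilpotently on [(U + I) / I];
   an element of this module with maximal annihilator is then killed by [m]. *)
Lemma exists_socle (I : R^o -> Prop) (U : R -> Prop) :
    submodule I -> (forall a x : R, U x -> U (a * x)) ->
    (forall x u : R, m x -> U u -> exists k, I (x ^+ k * u)) ->
    (exists2 u, U u & ~ I u) ->
  exists s, [/\ U s, ~ I s & forall x, m x -> I (x * s)].
Proof.
move=> Isub UM Unil [u0 Uu0 nIu0].
have [||s [Us nIs] smax] := @noeth_max _ Rnoeth R (fun u => U u /\ ~ I u)
    (fun u x => I (x * u)).
- by exists u0.
- move=> u _; split=> [|a x y Ix Iy]; first by rewrite mul0r; apply: submodule0.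
  by rewrite mulrDl -mulrA; apply: Isub.2.
exists s; split=> // x mx.
have [k] := Unil x s mx Us.
elim: k => [|k IH]; first by rewrite expr0 mul1r => /nIs.
have [/IH//|nI] := pselect (I (x ^+ k * s)).
rewrite exprS -mulrA => Ixk.
apply: (smax (x ^+ k * s)) => //; first by split=> //; apply: UM.
move=> y Iys; rewrite mulrCA; exact: (submoduleZ Isub).
Qed.

Hypothesis Rdim1 : krull_dim_eq R 1.

Lemma no_prime_chain3 (P0 P1 P2 : R^o -> Prop) : prime P0 -> prime P1 -> prime P2 ->
    (forall x, P0 x -> P1 x) -> (forall x, P1 x -> P2 x) ->
    (exists2 x, P1 x & ~ P0 x) -> (exists2 x, P2 x & ~ P1 x) -> False.
Proof.
move=> pP0 pP1 pP2 P01 P12 [x P1x nP0x] [y P2y nP1y].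
pose p (i : 'I_3) : {pred R} := fun x => `[< tnth [tuple P0; P1; P2] i x >].
suff /Rdim1.2 : prime_chain p by [].
split=> [i|i j].
  have [[P_0 P_D] P_1 P_p] : prime (tnth [tuple P0; P1; P2] i).
    by case: i => [[|[|[|//]]] lti]; rewrite (tnth_nth P0).
  split; first split.
  - exact/asboolP.
  - by apply/negP => /asboolP.
  - by move=> a u v /asboolP Pu /asboolP Pv; apply/asboolP/P_D.
  - by move=> u v /asboolP/P_p[]?; apply/orP; [left|right]; apply/asboolP.
case: i j => [[|[|[|//]]] ?] [[|[|[|//]]] ?] //= _; split.
- by move=> z /asboolP Pz; apply/asboolP/P01.
- by move=> /(_ x) H; apply: nP0x; apply/asboolP/H/asboolP.
- by move=> z /asboolP Pz; apply/asboolP/P12/P01.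
- by move=> /(_ x) H; apply: nP0x; apply/asboolP/H/asboolP/P12.
- by move=> z /asboolP Pz; apply/asboolP/P12.
- by move=> /(_ y) H; apply: nP1y; apply/asboolP/H/asboolP.
Qed.

(** In a chain of two primes, an element of the larger one outside the smaller one is not
    nilpotent. *)
Lemma exists_not_nilpotent : exists2 x : R, m x & forall n, x ^+ n <> 0.
Proof.
have [[p [pprime pchain]] _] := Rdim1.
have primeP i : prime (fun x : R^o => x \in p i).
  have [[p0 p1 pD] pp] := pprime i; split; [split|exact/negP|] => //.
  by move=> x y /pp/orP.
have [p01 np10] := pchain ord0 ord_max isT.
have [x px npx] : exists2 x, x \in p ord_max & x \notin p ord0.
  apply: contrapT => H; apply: np10 => x px.
  by apply: contrapT => /negP npx; apply: H; exists x.
exists x; first exact: (prime_local (primeP ord_max)).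
move=> n xn0; move/negP: npx; apply.
apply: (prime_expr (primeP ord0) (n := n)); rewrite xn0.
by case: (primeP ord0) => [[]].
Qed.

Lemma ann_submodule (x : R) : submodule (fun c : R^o => c * x = 0).
Proof.
split=> [|a c c' cx c'x]; first exact: mul0r.
by rewrite mulrDl -mulrA cx c'x mulr0 addr0.
Qed.

(** The annihilators of the powers of [y] ascend, and a maximal one is compared with that of
    [y ^+ (k + k)]. As [k] is positive, the power stays in [m] when [y] is in [m]. *)
Lemma exists_stable_power (y : R) : exists2 k, (0 < k)%N &
  forall c, c * y ^+ k * y ^+ k = 0 -> c * y ^+ k = 0.
Proof.
have [||k k0 kmax] := @noeth_max _ Rnoeth nat (fun k => (0 < k)%N) (fun k c => c * y ^+ k = 0).
- by exists 1%N.
- by move=> k _; apply: ann_submodule.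
exists k => // c e; apply: (kmax (k + k)%N); first by rewrite addn_gt0 k0.
  by move=> x xk; rewrite exprD mulrA xk mul0r.
by rewrite exprD mulrA.
Qed.

(* Take [r] in [m] with [Ann r = Ann r^2] and [Ann r] minimal. For [y] in [m]
   annihilated by [r] and a power [z] of [y] with [Ann z = Ann z^2], the element
   [r + z] has the annihilator [Ann r :&: Ann z], so that [y z = 0]. *)
Lemma exists_nil_annihilator : exists r : R,
  [/\ m r, forall c : R, c * r * r = 0 -> c * r = 0 &
      forall c : R, c * r = 0 -> exists k, c ^+ k = 0].
Proof.
pose F r := m r /\ forall c : R, c * r * r = 0 -> c * r = 0.
(* The double annihilator of [r] grows as [Ann r] shrinks, so a maximal one provides a minimal
   [Ann r]. *)
pose annann r (x : R^o) := forall c : R, c * r = 0 -> c * x = 0.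
have [||r [mr rst] rmax] := @noeth_max _ Rnoeth R F annann.
- by exists 0; split=> [|c]; [exact: (submodule0 msub) | rewrite !mulr0].
- move=> r _; split=> [c _|a x y xr yr c cr]; first exact: mulr0.
  by rewrite mulrDr yr // addr0 mulrCA xr ?mulr0.
have ann_nil (y : R) : m y -> y * r = 0 -> exists k, y ^+ k = 0.
  move=> my yr; have [[//|k] _ kst] := exists_stable_power y.
  set z := y ^+ k.+1 in kst.
  have rz : r * z = 0 by rewrite /z exprS mulrA [r * y]mulrC yr mul0r.
  have ann c : c * (r + z) = 0 -> c * r = 0 /\ c * z = 0.
    move=> e; have cr : c * r = 0.
      apply: rst; have : c * (r + z) * r = 0 by rewrite e mul0r.
      by rewrite mulrDr mulrDl -[c * z * r]mulrA [z * r]mulrC rz mulr0 addr0.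
    by split=> //; move: e; rewrite mulrDr cr add0r.
  have Frz : F (r + z).
    split.
      apply: (submoduleD msub) => //; rewrite /z exprSr.
      exact: (submoduleZ msub).
    move=> c /ann[]; rewrite !mulrDr !mulrDl -!mulrA [z * r]mulrC rz mulr0 !addr0 add0r.
    by rewrite !mulrA => /rst -> /kst ->; rewrite addr0.
  have yrz : y * (r + z) = 0.
    apply: (rmax _ Frz (fun x xr c e => xr c (ann c e).1)) => //.
  have [_ yz] := ann _ yrz.
  by exists k.+2; rewrite exprS.
exists r; split=> // c cr; apply: (ann_nil) => //.
have [x mx xnil] := exists_not_nilpotent.
(* [Ann r] is proper, hence inside [m]: if [r] were 0, every element of [m] would be nilpotent. *)
apply: (mmax (ann_submodule r)) cr => r1; rewrite mul1r in r1.
by have [|k xk] := ann_nil x mx; [rewrite r1 mulr0 | case: (xnil k)].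
Qed.

(** The alternatives are depth 0 and depth 1. A power of each element of [m] is a multiple of [r],
    so [exists_socle] applies to [Ann r] when it is nonzero, and otherwise to [R / (r)]. *)
Lemma socle_dichotomy :
  (exists2 s : R, s <> 0 & forall x, m x -> x * s = 0) \/
  (exists r s : R, [/\ m r, forall c : R, c * r = 0 -> c = 0,
     ~ (exists c, s = c * r) & forall x, m x -> exists c, x * s = c * r]).
Proof.
have [r [mr rst rnil]] := exists_nil_annihilator.
have r_neq0 : r <> 0.
  have [x mx xnil] := exists_not_nilpotent.
  by move=> r0; have [|k xk] := rnil x; [rewrite r0 mulr0 | case: (xnil k)].
have rRsub := principal_submodule r.
(* [r] lies in no minimal prime, hence in no prime other than [m]. *)
have mnil x : m x -> exists k c, x ^+ k = c * r.
  move=> mx; apply: contrapT => H.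
  have [|||P [Pprime rP Px]] := @exists_prime_avoiding _ Rnoeth
    (fun y => exists k, y = x ^+ k) _ _ _ rRsub.
  - by exists 0%N.
  - by move=> _ _ [k ->] [l ->]; exists (k + l)%N; rewrite exprD.
  - by move=> y [c yc] [k yk]; apply: H; exists k, c; rewrite -yk.
  have nPx : ~ P x by move=> /Px; apply; exists 1%N.
  have Pr : P r by apply: rP; exists 1; rewrite mul1r.
  (* [P'] is a prime inside [P] that misses [r], so [P'], [P], [m] is too long a chain. It exists
     because [c * r ^+ k = 0] gives [c * r = 0] by the stability of [Ann r], so that [c] is
     nilpotent and lies in [P]. *)
  have [|||P' [P'prime _ P'T]] := @exists_prime_avoiding _ Rnoeth
    (fun y => exists k, exists2 c, ~ P c & y = c * r ^+ k) _ _ _ (submodule_eq0 R^o).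
  - by exists 0%N, 1; [case: Pprime | rewrite mulr1].
  - move=> _ _ [k [c nPc ->]] [l [c' nPc' ->]].
    exists (k + l)%N, (c * c'); last by rewrite exprD mulrACA.
    by case: Pprime => _ _ H' /H'[].
  - move=> y -> [k [c nPc]] /esym e; apply: nPc.
    have [j cj] : exists j, c ^+ j = 0.
      apply: rnil; elim: k e => [|k IH]; first by rewrite expr0 mulr1 => ->; rewrite mul0r.
      case: k IH => [|k] IH; first by rewrite expr1.
      by rewrite !exprSr !mulrA => /rst; rewrite -mulrA -exprSr.
    by apply: (prime_expr Pprime (n := j)); rewrite cj; case: Pprime => [[]].
  apply: (no_prime_chain3 P'prime Pprime local_prime).
  - move=> y P'y; apply: contrapT => nPy; apply: (P'T _ P'y).
    by exists 0%N, y; rewrite // mulr1.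
  - exact: prime_local.
  - exists r => // /P'T; apply; exists 1%N, 1; first by case: Pprime.
    by rewrite mul1r.
  - by exists x.
have [[c rc c0]|rreg] := pselect (exists2 c : R, c * r = 0 & c <> 0); [left|right].
  have [||x u mx ur||s [sr s0 ms]] := @exists_socle (fun y => y = 0) (fun c => c * r = 0).
  - exact: (@submodule_eq0 R R^o).
  - by move=> a x xr; rewrite -mulrA xr mulr0.
  - have [k [a xk]] := mnil x mx; exists k.
    by rewrite xk -mulrA [r * u]mulrC ur mulr0.
  - by exists c.
  - by exists s.
have [||x u mx _||s [_ s0 ms]] := @exists_socle (fun y => exists c, y = c * r) (fun=> True).
- exact: rRsub.
- by [].
- have [k [a xk]] := mnil x mx; exists k, (a * u).
  by rewrite xk mulrAC.
- exists 1 => // -[c c1]; case: m1; rewrite c1; exact: (submoduleZ msub).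
exists r, s; split=> // c cr; apply: contrapT => c0; apply: rreg; by exists c.
Qed.

End LocalRing.

(** * Linear maps and free modules *)

Section LinearMaps.
Variable R : comNzRingType.

Lemma linear_exists (A B : lmodType R) (f : A -> B) : linear f ->
  exists h : {linear A -> B}, forall x, h x = f x.
Proof.
move=> flin; pose F := GRing.isLinear.Build R A B _ f flin.
pose h : {linear A -> B} := HB.pack f F; by exists h.
Qed.

Lemma in_spanP (L : lmodType R) (s : seq L) (y : L) :
  in_span s y <-> exists c : 'I_(size s) -> R, y = \sum_(i < size s) c i *: s`_i.
Proof.
split=> [|[c ->]].
  elim: s y => [|g s IH] y /=; first by move=> ->; exists (fun=> 0); rewrite big_ord0.
  move=> [c /IH[c' yc]]; exists (fun i => oapp c' c (unlift ord0 i)).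
  rewrite big_ord_recl unlift_none /= -(subrK (c *: g) y) yc addrC; congr (_ + _).
  by apply: eq_bigr => i _; rewrite liftK.
have sP := in_span_submodule s; apply: big_ind => [|u v|i _].
- exact: (submodule0 sP).
- exact: (submoduleD sP).
- by apply: (submoduleZ sP); apply/mem_in_span/mem_nth.
Qed.

Lemma fgen_image (L : lmodType R) (S : L -> Prop) : submodule S -> fgen S ->
  exists n (a : {linear 'rV[R]_n -> L}), forall y, S y <-> exists x, y = a x.
Proof.
move=> Ssub [s sS Ss]; exists (size s).
pose f (x : 'rV[R]_(size s)) := \sum_(i < size s) x 0 i *: s`_i.
have flin : linear f.
  move=> c x y; rewrite /f scaler_sumr -big_split; apply: eq_bigr => i _ /=.
  by rewrite !mxE scalerDl scalerA.
have [a aE] := linear_exists flin; exists a => y; split.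
  move=> /Ss/in_spanP[c ->]; exists (\row_i c i).
  by rewrite aE /f; apply: eq_bigr => i _; rewrite mxE.
move=> [x ->]; rewrite aE; apply: (in_span_sub Ssub sS).
by apply/in_spanP; exists (x 0).
Qed.

Lemma row_fg n : finitely_generated 'rV[R]_n.
Proof.
exists n, (delta_mx 0) => x; exists (x 0); rewrite {1}[x]matrix_sum_delta big_ord1.
by [].
Qed.

Lemma regular_fg : finitely_generated R^o.
Proof. by exists 1%N, (fun=> 1) => x; exists (fun=> x); rewrite big_ord1 [RHS]mulr1. Qed.

(** Free modules are projective: preimages are chosen on the standard basis. *)
Lemma row_lift n (A B : lmodType R) (q : {linear A -> B}) (v : {linear 'rV[R]_n -> B}) :
    (forall x, exists a, v x = q a) ->
  exists psi : {linear 'rV[R]_n -> A}, forall x, v x = q (psi x).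
Proof.
move=> vq; have [g gE] := choice (fun i => vq (delta_mx 0 i)).
pose f (x : 'rV[R]_n) := \sum_(i < n) x 0 i *: g i.
have flin : linear f.
  move=> c x y; rewrite /f scaler_sumr -big_split; apply: eq_bigr => i _ /=.
  by rewrite !mxE scalerDl scalerA.
have [psi psiE] := linear_exists flin; exists psi => x.
rewrite psiE {1}[x]matrix_sum_delta big_ord1 /f !linear_sum; apply: eq_bigr => i _.
by rewrite !linearZ /= gE.
Qed.

End LinearMaps.

(** * Submodules as modules in their own right *)

Section SubmoduleType.
Variables (R : comNzRingType) (L : lmodType R) (p : {pred L}).
Hypothesis psub : submod_closed p.

(** The closure proof is a parameter so that the algebraic structure can be attached to an arbitrary
    [p]. *)
Definition submod_pred of submod_closed p : {pred L} := p.

HB.instance Definition _ :=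
  GRing.isSubmodClosed.Build R L (submod_pred psub) psub.

Definition submod_type : Type := {x : L | x \in submod_pred psub}.

HB.instance Definition _ := SubChoice.on submod_type.
HB.instance Definition _ := [SubChoice_isSubLmodule of submod_type by <:].

End SubmoduleType.

(** * Extension of maps into injective modules *)

Section Injective.
Variables (R : comNzRingType) (X : lmodType R).
Hypothesis Xinj : injective_module X.

(* Extension along the projection of the graph [G], so that no quotient modules
   are needed. *)
Lemma injective_rel (B : lmodType R) (G : B -> X -> Prop) :
    G 0 0 -> (forall a b x b' x', G b x -> G b' x' -> G (a *: b + b') (a *: x + x')) ->
    (forall x, G 0 x -> x = 0) ->
  exists h : {linear B -> X}, forall b x, G b x -> h b = x.
Proof.
move=> G0 GD Ginj; pose p : {pred (B * X)%type} := fun u => `[< G u.1 u.2 >].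
have psub : submod_closed p.
  split=> [|a u v /asboolP Gu /asboolP Gv]; first exact/asboolP.
  by apply/asboolP/GD.
pose i : {linear submod_type psub -> B} := fst \o val.
pose f : {linear submod_type psub -> X} := snd \o val.
have iinj : injective i.
  apply: raddf_inj => u iu0; apply: val_inj => /=.
  have /asboolP : val u \in p := valP u.
  have u1 : (val u).1 = 0 := iu0.
  by rewrite u1 => /Ginj u2; rewrite (surjective_pairing (val u)) u1 u2.
have [h hE] := Xinj f iinj; exists h => b x Gbx.
have Gp : (b, x) \in submod_pred psub by apply/asboolP.
exact: (hE (exist _ (b, x) Gp)).
Qed.

Lemma injective_factor (A B : lmodType R) (a : {linear A -> B}) (k : {linear A -> X}) :
    (forall x, a x = 0 -> k x = 0) ->
  exists h : {linear B -> X}, forall x, k x = h (a x).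
Proof.
move=> ker.
have [|c b x b' x'|x|h hE] := @injective_rel B (fun b x => exists2 y, b = a y & x = k y).
- by exists 0; rewrite linear0.
- by move=> [y -> ->] [y' -> ->]; exists (c *: y + y'); rewrite linearP.
- by move=> [y /esym /ker ky ->].
by exists h => x; apply/esym/hE; exists x.
Qed.

(** The condition on [x] says that sending [b] to [x] is well defined on [(S + R b) / S]; this map
    is then extended. *)
Lemma injective_adjoin (B : lmodType R) (S : B -> Prop) (b : B) (x : X) :
    submodule S -> (forall r : R, S (r *: b) -> r *: x = 0) ->
  exists h : {linear B -> X}, (forall y, S y -> h y = 0) /\ h b = x.
Proof.
move=> Ssub Sx.
have [|c y z y' z'|z|h hE] :=
  @injective_rel B (fun y z => exists2 r : R, S (y - r *: b) & z = r *: x).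
- by exists 0; rewrite scale0r // subr0; exact: (submodule0 Ssub).
- move=> [r Sy ->] [r' Sy' ->]; exists (c * r + r').
    have -> : c *: y + y' - (c * r + r') *: b = c *: (y - r *: b) + (y' - r' *: b).
      by rewrite scalerDl scalerBr -scalerA opprD addrACA.
    exact: Ssub.2.
  by rewrite scalerDl scalerA.
- move=> [r Sr ->]; apply: Sx.
  have -> : r *: b = -1 *: (0 - r *: b) by rewrite scaleN1r sub0r opprK.
  exact: (submoduleZ Ssub).
exists h; split=> [y Sy|]; apply: hE.
  by exists 0; rewrite scale0r ?subr0.
by exists 1; rewrite scale1r // subrr; exact: (submodule0 Ssub).
Qed.

(** The case [B = R], where a map from [R / J] is identified with its value at 1, an element killed
    by [J]. *)
Lemma injective_adjoin1 (J : R^o -> Prop) (s : R) (x : X) :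
    submodule J -> (forall r : R, J (r * s) -> r *: x = 0) ->
  exists w, s *: w = x /\ forall r : R, J r -> r *: w = 0.
Proof.
move=> Jsub Jx; have [h [hJ hs]] := @injective_adjoin R^o J s x Jsub Jx.
exists (h 1); split; last first.
  by move=> r Jr; rewrite -linearZ -[RHS](hJ _ Jr); congr (h _); apply: mulr1.
by rewrite -hs -linearZ; congr (h _); apply: mulr1.
Qed.

End Injective.

(** * Ext into [M1], computed from an injective resolution *)

Section Resolution.
Variable R : comNzRingType.
Hypothesis Rnoeth : noetherian R.
Variables (M1 : lmodType R) (X : nat -> lmodType R).
Variables (e : {linear M1 -> X 0%N}) (d : forall k, {linear X k -> X k.+1}).
Hypothesis M1_fg : finitely_generated M1.
Hypothesis Xinj : forall k, injective_module (X k).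
Hypothesis e_exact : exact_at e (d 0%N).
Hypothesis d_exact : forall k, exact_at (d k) (d k.+1).

Lemma d_d k x : d k.+1 (d k x) = 0.
Proof. by apply/d_exact; exists x. Qed.

(* Modulo [coboundary k], these maps form Ext^k(N / S, M1). *)
Definition cocycle k (N : lmodType R) (S : N -> Prop) (phi : N -> X k) : Prop :=
  [/\ linear phi, forall x, S x -> phi x = 0 & forall x, d k (phi x) = 0].

(** No differential enters degree 0, where Ext is Hom; hence the match on [k]. *)
Definition coboundary k : forall N : lmodType R, (N -> Prop) -> (N -> X k) -> Prop :=
  if k is j.+1 then fun N S phi => exists psi : {linear N -> X j},
      (forall x, S x -> psi x = 0) /\ phi = (fun x => d j (psi x))
  else fun N S phi => phi = 0.

Lemma cocycle_submodule k (N : lmodType R) (S : N -> Prop) :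
  submodule (@cocycle k N S).
Proof.
split=> [|a f g [fl fS fd] [gl gS gd]].
  have z x : (0 : N -> X k) x = 0 by [].
  by split=> [a x y|x _|x]; rewrite !z ?scaler0 ?addr0 ?linear0.
split=> [c x y|x Sx|x] /=.
- have -> : forall z, (a *: f + g) z = a *: f z + g z by [].
  by rewrite fl gl !scalerDr !scalerA [a * c]mulrC addrACA.
- have -> : (a *: f + g) x = a *: f x + g x by [].
  by rewrite fS // gS // scaler0 addr0.
- have -> : (a *: f + g) x = a *: f x + g x by [].
  by rewrite linearP fd gd scaler0 addr0.
Qed.

Lemma coboundary_submodule k (N : lmodType R) (S : N -> Prop) :
  submodule (@coboundary k N S).
Proof.
case: k => [|k]; first exact: submodule_eq0.
split=> [|a _ _ [u [uS ->]] [v [vS ->]]].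
  exists \0; split=> //; apply/funext => x; by rewrite linear0.
exists (a \*: u \+ v); split=> [x Sx|]; first by rewrite /= uS // vS // scaler0 addr0.
by apply/funext => x; rewrite /= linearP.
Qed.

(** Evaluation at the first generator takes values in the noetherian module [M1], and its kernel is
    handled by induction on [s]. *)
Lemma hom_fgen (N : lmodType R) (s : seq N) (C : (N -> X 0%N) -> Prop) :
    submodule C -> (forall f, C f -> forall x, exists y, f x = e y) ->
    (forall f, C f -> (forall x, x \in s -> f x = 0) -> f = 0) ->
  fgen C.
Proof.
elim: s C => [|g s IH] C Csub Ce C0.
  exists [::] => // f Cf; exact: C0.
apply: (@fgen_ext _ _ M1 (fun f y => f g = e y)) => //.
- by rewrite linear0.
- move=> a u v u' v' ug u'g; rewrite linearP -ug -u'g. by [].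
- by move=> f /Ce.
- apply: fgen_sub => //; split=> [|a y z [u Cu uy] [v Cv vz]].
    by exists 0; rewrite ?linear0 //; apply: (submodule0 Csub).
  by exists (a *: u + v); [apply: Csub.2 | rewrite linearP -uy -vz].
apply: IH => [|f [Cf _]|f [Cf fg] fs].
- split=> [|a u v [Cu ug] [Cv vg]].
    by split; [apply: (submodule0 Csub) | rewrite linear0].
  split; first exact: Csub.2.
  have -> : (a *: u + v) g = a *: u g + v g by [].
  by rewrite ug vg linear0 scaler0 addr0.
- exact: Ce.
- apply: C0 => // x; rewrite inE => /predU1P[->|]; last exact: fs.
  by rewrite fg linear0.
Qed.

(** Dimension shifting. With ['rV_n] mapping onto [N], the syzygy module of [N / S] is the image of
    [a], that is, ['rV_l] modulo the kernel of [a]; pairs [N], [S] therefore suffice for the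
    induction. *)
Lemma ext_fgen k (N : lmodType R) (S : N -> Prop) :
    finitely_generated N -> submodule S ->
  exists2 s, forall f, f \in s -> @cocycle k N S f &
    forall f, cocycle S f -> exists2 b, coboundary S b & in_span s (f - b).
Proof.
elim: k N S => [|k IH] N S Nfg Ssub.
  have [t _ tN] := fgenT Nfg.
  have [||f [fl _ _] ft|s sC sS] := @hom_fgen N t (cocycle S).
  - exact: cocycle_submodule.
  - by move=> f [_ _ fd] x; apply/e_exact.
  - apply/funext => x; have [h hE] := linear_exists fl; rewrite -hE.
    apply: (in_span_sub (submodule_preim h (submodule_eq0 _)) _ (tN x I)) => g gt.
    by rewrite hE ft.
  by exists s => // f Cf; exists 0 => //; rewrite subr0; apply: sS.
have [n [p pE]] := fgen_image (submodule_setT N) (fgenT Nfg).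
have psurj y : exists x, y = p x by apply/pE.
have S'sub := submodule_preim p Ssub.
have [l [a aE]] := fgen_image S'sub (fgen_sub Rnoeth (row_fg R n) S'sub).
have pa x : S (p (a x)) by apply/aE; exists x.
have kersub := submodule_preim a (submodule_eq0 _).
have [s sC sS] := IH _ _ (row_fg R l) kersub.
(* Since projective modules [F'] -> [F] present [N / S], a class [f] lifts to
   [psi : F -> X k], and restricting [psi] to the syzygy module is the
   connecting isomorphism onto the previous Ext. *)
pose T (u : 'rV[R]_l -> X k) (f : N -> X k.+1) :=
  exists psi : {linear 'rV[R]_n -> X k},
    (forall x, psi (a x) = u x) /\ (forall x, f (p x) = d k (psi x)).
have [|c u f u' f' [psi [pu pf]] [psi' [pu' pf']]|u us|s' s'C s'S] :=
  @in_span_rel _ _ _ T (cocycle S) s.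
- by exists \0; split=> // x; rewrite linear0.
- exists (c \*: psi \+ psi'); split=> x; first by rewrite /= pu pu'.
  by rewrite /= linearP -pf -pf'.
- have [ul uker ud] := sC u us; have [h hE] := linear_exists ul.
  have [x ax0|psi psiE] := injective_factor (@Xinj k) (a := a) (k := h).
    by rewrite hE uker.
  have [x px0|f fE] := injective_factor (@Xinj k.+1) (a := p) (k := d k \o psi).
    have [y ->] : exists y, x = a y by apply/aE; rewrite px0; apply: submodule0.
    by rewrite /= -psiE hE ud.
  exists (f : N -> X k.+1); first by exists psi; split=> x; rewrite -?psiE -?fE ?hE.
  split=> [|x Sx|x]; first exact: linearP.
    have [y xy] := psurj x; rewrite xy -fE /=.
    have [z ->] : exists z, y = a z by apply/aE; rewrite -xy.
    by rewrite -psiE hE ud.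
  by have [y ->] := psurj x; rewrite -fE /= d_d.
exists s' => // f [fl fS fd]; have [F FE] := linear_exists fl.
have [x|psi psiE] := @row_lift R n _ _ (d k) (F \o p).
  by apply/d_exact; rewrite /= FE fd.
have [|b Bb sb] := sS (fun x => psi (a x)).
  split=> [c x y|x /= ->|x]; first by rewrite !linearP.
    by rewrite linear0.
  by rewrite -psiE /= FE fS.
have [f' sf' [psi' [psi'a f'p]]] := s'S _ sb.
(* The coboundary [b] extends along [a] to a map [b'] killed by [d k], so subtracting [b'] from
   [psi] leaves [d k (psi x)] unchanged. *)
have [b' b'a db'] : exists2 b' : {linear 'rV[R]_n -> X k},
    forall x, b x = b' (a x) & forall x, d k (b' x) = 0.
  case: (k) b Bb {sb psi'a} => [b ->|j b [h [hker ->]]].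
    by exists \0 => // x; rewrite linear0.
  have [h' h'E] := injective_factor (@Xinj j) hker.
  by exists (d j \o h') => x /=; rewrite ?d_d ?h'E.
(* This difference vanishes on the image of [a], the preimage of [S]; it descends to a map on [N]
   that kills [S] and bounds [f - f']. *)
have [x px0|g gE] := injective_factor (@Xinj k) (a := p) (k := psi \- psi' \- b').
  have [y ->] : exists y, x = a y by apply/aE; rewrite px0; apply: submodule0.
  rewrite /= psi'a.
  have -> : ((fun x => psi (a x)) - b) y = psi (a y) - b y by [].
  by rewrite b'a subKr subrr.
exists (f - f'); last by rewrite subKr.
exists g; split.
  move=> x Sx; have [y xy] := psurj x; rewrite xy -gE.
  have [z yz] : exists z, y = a z by apply/aE; rewrite -xy.
  rewrite yz /= psi'a.
  have -> : ((fun x => psi (a x)) - b) z = psi (a z) - b z by [].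
  by rewrite b'a subKr subrr.
apply/funext => x; have [y ->] := psurj x; rewrite -gE /= !linearB /= db' subr0.
by rewrite -psiE -f'p /= FE.
Qed.


(* Elementwise form of [Ext^(k.+1)(R / J, M1) = 0]. *)
Definition ext_vanish k (J : R^o -> Prop) : Prop :=
  forall z : X k.+1, d k.+1 z = 0 -> (forall r : R, J r -> r *: z = 0) ->
  exists2 y : X k, z = d k y & forall r : R, J r -> r *: y = 0.

(** Long exact sequence of Ext for [0 -> R / (J : a) -> R / J -> R / (J + (a)) -> 0], the first map
    being multiplication by [a]. *)
Lemma ext_vanish_colon k (J : R^o -> Prop) (a : R) : submodule J ->
    ext_vanish k (fun r => J (r * a)) ->
    ext_vanish k (fun r => exists c : R, J (r - c * a)) ->
  ext_vanish k J.
Proof.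
move=> Jsub Va Vsum z dz Jz.
have [||y ay ycol] := Va (a *: z).
- by rewrite linearZ /= dz scaler0.
- by move=> r Jra; rewrite scalerA Jz.
have [y' [ay' Jy']] := injective_adjoin1 (@Xinj k) (s := a) Jsub ycol.
have [||y'' zy'' Jy''] := Vsum (z - d k y').
- by rewrite linearB /= dz d_d subr0.
- move=> r [c Jrc]; rewrite -(subrK (c * a) r) scalerDl -scalerA scalerBr -linearZ /=.
  rewrite Jz // Jy' // linear0 subr0 add0r scalerBr ay.
  by rewrite -linearZ /= ay' subrr scaler0.
exists (y' + y''); first by rewrite linearD /= -zy'' addrC subrK.
move=> r Jr; rewrite scalerDr Jy' // Jy'' ?addr0 //.
by exists 0; rewrite mul0r subr0.
Qed.

(** [h] is built generator by generator. The correction for a new generator vanishes on the kernel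
    of [f - d k h], which contains [S] and all generators treated before. *)
Lemma ext_vanish_module k (N : lmodType R) (S : N -> Prop) (f : {linear N -> X k.+1}) :
    finitely_generated N -> (forall J, submodule J -> ext_vanish k J) ->
    (forall x, S x -> f x = 0) -> (forall x, d k.+1 (f x) = 0) ->
  exists h : {linear N -> X k}, (forall x, S x -> h x = 0) /\ forall x, f x = d k (h x).
Proof.
move=> /fgenT[s _ sN] V fS fd.
suff [h [hS hs]] : exists h : {linear N -> X k}, (forall x, S x -> h x = 0) /\
    forall x, x \in s -> f x = d k (h x).
  exists h; split=> // x; apply/eqP; rewrite -subr_eq0; apply/eqP.
  apply: (in_span_sub (submodule_preim (f \- (d k \o h)) (submodule_eq0 _)) _ (sN x I)).
  by move=> g /hs /= ->; rewrite subrr.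
elim: s {sN} => [|g s [h [hS hs]]].
  by exists \0; split.
pose F : {linear N -> X k.+1} := f \- (d k \o h).
have FE x : F x = f x - d k (h x) by [].
have ksub := submodule_preim F (submodule_eq0 _).
have [|||y Fy Fky] := V (fun r : R^o => F ((r : R) *: g) = 0) _ (F g).
- split=> [|a r r' rg r'g]; first by rewrite scale0r linear0.
  by rewrite scalerDl -scalerA linearP rg r'g scaler0 addr0.
- by rewrite FE linearB /= fd d_d subr0.
- by move=> r rg; rewrite -linearZ.
have [h' [h'k h'g]] := injective_adjoin (@Xinj k) ksub Fky.
exists (h \+ h'); split=> [x Sx|x].
  by rewrite /= hS // h'k ?addr0 // FE fS // hS // linear0 subr0.
rewrite inE => /predU1P[->|xs].
  by rewrite /= h'g linearD /= -Fy FE addrC subrK.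
by rewrite /= h'k ?addr0 /= ?FE -?hs ?subrr.
Qed.

End Resolution.

(** * Nakayama's lemma and vanishing of Ext over a local ring *)

Section LocalVanishing.
Variable R : comNzRingType.
Hypothesis Rnoeth : noetherian R.
Variable m : R^o -> Prop.
Hypotheses (msub : submodule m) (m1 : ~ m 1).
Hypothesis mmax : forall I : R^o -> Prop, submodule I -> ~ I 1 -> forall x, I x -> m x.

Lemma nakayama (H : lmodType R) (C B : H -> Prop) (s : seq H) (x : R) :
    m x -> submodule C -> submodule B -> (forall f, f \in s -> C f) ->
    (forall f, C f -> exists2 b, B b & in_span s (f - b)) ->
    (forall f, C f -> exists2 g, C g & B (f - x *: g)) ->
  forall f, C f -> B f.
Proof.
move=> mx Csub Bsub; elim: s => [|g s IH] sC Cspan CxC.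
  by move=> f /Cspan[b Bb /= /eqP]; rewrite subr_eq0 => /eqP ->.
apply: IH => // [f fs|f Cf]; first by apply: sC; rewrite inE fs orbT.
have sP := in_span_submodule s.
have [b' Bb' sg] : exists2 b, B b & in_span s (g - b).
  have [g' /Cspan[b Bb [c sg']] Bg] := CxC g (sC g (mem_head _ _)).
  have [v v1] : exists v, v * (1 - x * c) = 1.
    by apply: (unit_1B msub m1 mmax); rewrite mulrC; apply: (submoduleZ msub).
  exists (v *: (g - x *: g' + x *: b)).
    apply: (submoduleZ Bsub); apply: (submoduleD Bsub) => //; exact: (submoduleZ Bsub).
  have -> : g - v *: (g - x *: g' + x *: b) = (v * x) *: (g' - b - c *: g).
    rewrite -{1}[g]scale1r -v1 -!scalerA -scalerBr; congr (_ *: _).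
    rewrite scalerBl scale1r !scalerBr scalerA.
    by rewrite opprD opprB addrA [g - _ + _]addrC addrA subrK addrAC.
  exact: (submoduleZ sP).
have [b Bb [c sf]] := Cspan f Cf.
exists (b + c *: b'); first by apply: (submoduleD Bsub) => //; apply: (submoduleZ Bsub).
have -> : f - (b + c *: b') = (f - b - c *: g) + c *: (g - b').
  by rewrite scalerBr addrA subrK opprD addrA.
by apply: (submoduleD sP) => //; apply: (submoduleZ sP).
Qed.

Variables (M1 : lmodType R) (X : nat -> lmodType R).
Variables (e : {linear M1 -> X 0%N}) (d : forall k, {linear X k -> X k.+1}).
Hypothesis M1_fg : finitely_generated M1.
Hypothesis Xinj : forall k, injective_module (X k).
Hypothesis e_exact : exact_at e (d 0%N).
Hypothesis d_exact : forall k, exact_at (d k) (d k.+1).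

(** Multiplication by [x] is injective on [R / P] with cokernel [R / (P + (x))]. Vanishing for the
    cokernel one degree higher makes [x] surjective on Ext^(k.+1)(R / P, M1), and Nakayama's lemma
    applies. *)
Lemma ext_vanish_prime k (P : R^o -> Prop) (x : R) : prime P -> m x -> ~ P x ->
    ext_vanish d k.+1 (fun r => exists c : R, P (r - c * x)) ->
  ext_vanish d k P.
Proof.
move=> [Psub P1 Pp] mx nPx Vx.
have [s sC sS] := ext_fgen Rnoeth M1_fg Xinj e_exact d_exact k.+1 (regular_fg R) Psub.
have CB := nakayama mx (cocycle_submodule d k.+1 P) (coboundary_submodule d k.+1 P) sC sS.
move=> z dz Pz; pose f (r : R^o) := (r : R) *: z.
have [f' [fl fP fd]||y [yP /(congr1 (@^~ 1))]] := CB _ f.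
- have [|w [xw Pw]] := injective_adjoin1 (@Xinj k.+1) (s := x) (x := f' 1) Psub.
    move=> r /Pp[Pr|/nPx//]; have [h hE] := linear_exists fl.
    by rewrite -hE -linearZ hE -(fP _ Pr); congr f'; apply: mulr1.
  have killed (r c : R) : P (r - c * x) -> r *: d k.+1 w = 0.
    move=> Prc; rewrite -(subrK (c * x) r) -linearZ /= scalerDl -scalerA Pw // xw add0r.
    by rewrite linearZ /= fd scaler0.
  have [||y dwy Py] := Vx (d k.+1 w).
  - exact: (d_d d_exact).
  - by move=> r [c /killed].
  have xy : x *: y = 0.
    by apply: Py; exists 1; rewrite mul1r subrr; apply: (submodule0 Psub).
  exists (fun r : R^o => (r : R) *: (w - y)).
    split=> [a r r'|r Pr|r]; first by rewrite scalerDl scalerA.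
      rewrite scalerBr Pw // Py ?subrr //.
      by exists 0; rewrite mul0r subr0.
    by rewrite linearZ /= linearB /= dwy subrr scaler0.
  suff -> : f' - x *: (fun r : R^o => (r : R) *: (w - y)) = 0.
    exact: (submodule0 (coboundary_submodule d k.+1 P)).
  apply/funext => r; have [h hE] := linear_exists fl.
  have -> : (f' - x *: (fun r : R^o => (r : R) *: (w - y))) r = f' r - x *: (r *: (w - y)) by [].
  rewrite scalerA mulrC -scalerA scalerBr xw xy subr0 -!hE -linearZ.
  apply/eqP; rewrite subr_eq0; apply/eqP; congr (h _); exact/esym/mulr1.
- split=> [a r r'|r /Pz //|r]; first by rewrite /f scalerDl scalerA.
  by rewrite /f linearZ /= dz scaler0.
rewrite /f scale1r => zy; exists (y 1) => // r Pr.
by rewrite -linearZ -[RHS](yP _ Pr); congr (y _); apply: mulr1.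
Qed.

(** A maximal counterexample [J] is proper. If it is prime, it is [m] or falls under
    [ext_vanish_prime]; if [a * b] is in [J] with neither factor in [J], then [J : a] and [J + (a)]
    are strictly larger. *)
Lemma ext_vanish_step k : ext_vanish d k m ->
    (forall J, submodule J -> ext_vanish d k.+1 J) ->
  forall J, submodule J -> ext_vanish d k J.
Proof.
move=> Vm VS J0 J0sub; apply: contrapT => nV0.
have [||J [Jsub nV] Jmax] := @noeth_max _ Rnoeth _
    (fun J => submodule J /\ ~ ext_vanish d k J) (fun J => J).
- by exists J0.
- by move=> J [].
have larger (J' : R^o -> Prop) : submodule J' -> (forall x, J x -> J' x) ->
    (exists2 x, J' x & ~ J x) -> ext_vanish d k J'.
  move=> J'sub JJ' [x J'x nJx]; apply: contrapT => nV'; apply: nJx.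
  exact: (Jmax J').
have [J1|J1] := pselect (J 1).
  apply: nV => z _ Jz; exists 0 => [|r _]; last by rewrite scaler0.
  by rewrite linear0 -(Jz _ J1) scale1r.
have [Jprime|nprime] := pselect (prime J).
  have [[x mx nJx]|mJ] := pselect (exists2 x, m x & ~ J x).
    apply: nV; apply: (ext_vanish_prime Jprime mx nJx); apply: VS.
    exact: submodule_adjoin.
  apply: nV => z dz Jz; have [r mr|y zy my] := Vm z dz.
    by apply: Jz; apply: contrapT => nJr; apply: mJ; exists r.
  by exists y => // r /(mmax Jsub J1) /my.
apply: nprime; split=> // a b Jab; have [Ja|nJa] := pselect (J a); first by left.
right; apply: contrapT => nJb; apply: nV.
apply: (ext_vanish_colon Xinj d_exact (a := a) Jsub); apply: larger.
- split=> [|c r r' Jr Jr']; first by rewrite mul0r; apply: (submodule0 Jsub).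
  by rewrite mulrDl -mulrA; apply: Jsub.2.
- by move=> x Jx; rewrite mulrC; apply: (submoduleZ Jsub).
- by exists b => //; rewrite mulrC.
- exact: (submodule_adjoin (a : R^o) Jsub).
- by move=> x Jx; exists 0; rewrite mul0r subr0.
- by exists a => //; exists 1; rewrite mul1r subrr; apply: (submodule0 Jsub).
Qed.

Lemma ext_vanish_descent n j : (forall k, (n < k)%N -> forall x : X k, x = 0) ->
    (forall k, (j <= k)%N -> (forall J, submodule J -> ext_vanish d k.+1 J) ->
       ext_vanish d k m) ->
  forall k, (j <= k)%N -> forall J, submodule J -> ext_vanish d k J.
Proof.
move=> X0 Vm.
(* [i] bounds the distance from [k] up to [n]; for [i = 0] the module [X k.+1] is zero. *)
suff V i k : (n <= i + k)%N -> (j <= k)%N -> forall J, submodule J -> ext_vanish d k J.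
  by move=> k; apply: (V n); rewrite leq_addr.
elim: i k => [|i IH] k nk jk J Jsub.
  move=> z _ _; exists 0 => [|r _]; last by rewrite scaler0.
  by rewrite linear0 [z]X0.
have VS : forall J, submodule J -> ext_vanish d k.+1 J.
  by apply: IH; [rewrite addnS | apply: leqW].
exact: ext_vanish_step (Vm k jk VS) VS J Jsub.
Qed.

(** In [0 -> R / m -> R -> R / (s) -> 0], Ext^(k.+1) of [R] is zero, and so is Ext^(k.+2) of
    [R / (s)] by hypothesis. *)
Lemma ext_vanish_socle0 k (s : R) : s <> 0 -> (forall x, m x -> x * s = 0) ->
    (forall J, submodule J -> ext_vanish d k.+1 J) ->
  ext_vanish d k m.
Proof.
move=> s0 ms V z dz mz.
have [r rs0|w [sw _]] := injective_adjoin1 (@Xinj k.+1) (s := s) (x := z) (@submodule_eq0 R R^o).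
  by apply: mz; apply: (mmax (ann_submodule s)) rs0 => /=; rewrite mul1r.
have [||w' dww' sw'] := V _ (principal_submodule s) (d k.+1 w).
- exact: (d_d d_exact).
- by move=> _ [c ->]; rewrite -linearZ /= -scalerA sw linearZ /= dz scaler0.
have [y wy] : exists y, w - w' = d k y.
  by apply/d_exact; rewrite linearB /= dww' subrr.
exists (s *: y) => [|r mr]; last by rewrite scalerA ms // scale0r.
rewrite linearZ /= -wy scalerBr sw sw' ?subr0 //.
by exists 1; rewrite mul1r.
Qed.

(** The sequence is now [0 -> R / m -> R / (r) -> R / (r, s) -> 0]. Since [r] is regular, [R / (r)]
    has projective dimension at most 1, so its Ext vanishes from degree 2 on. *)
Lemma ext_vanish_socle1 k (r s : R) : m r -> (forall c, c * r = 0 -> c = 0) ->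
    ~ (exists c, s = c * r) -> (forall x, m x -> exists c, x * s = c * r) ->
    (forall J, submodule J -> ext_vanish d k.+2 J) ->
  ext_vanish d k.+1 m.
Proof.
move=> mr rreg nrs ms V z dz mz.
have rsub := principal_submodule r.
have [c [b csb]|w [sw rw]] := injective_adjoin1 (@Xinj k.+2) (s := s) (x := z) rsub.
  apply: mz; apply: contrapT => /(unit_notin mmax)[v vc]; apply: nrs.
  by exists (v * b); rewrite -[s]mul1r -vc -!mulrA csb.
have [||w' dww' sw'] := V _ (submodule_adjoin (s : R^o) rsub) (d k.+2 w).
- exact: (d_d d_exact).
- move=> c [c' rcc']; rewrite -(subrK (c' * s) c) -linearZ /= scalerDl -scalerA rw // sw.
  by rewrite add0r linearZ /= dz scaler0.
have rr : exists c, r = c * r by exists 1; rewrite mul1r.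
have rw' : r *: w' = 0.
  by apply: sw'; exists 0; rewrite scale0r subr0.
have ssw' : s *: w' = 0.
  by apply: sw'; exists 1; rewrite scale1r subrr; apply: (submodule0 rsub).
have [y0 wy] : exists y, w - w' = d k.+1 y.
  by apply/d_exact; rewrite linearB /= dww' subrr.
(* Dividing [y1] by the regular element [r] gives a boundary [d k y2] that corrects [y0] to an
   element killed by [r]. *)
have [y1 ry0] : exists y1, r *: y0 = d k y1.
  by apply/d_exact; rewrite linearZ /= -wy scalerBr rw // rw' subrr.
have [c /rreg ->|y2 [ry2 _]] :=
  injective_adjoin1 (@Xinj k) (s := r) (x := y1) (@submodule_eq0 R R^o).
  by rewrite scale0r.
have ry : r *: (y0 - d k y2) = 0.
  by rewrite scalerBr -linearZ /= ry2 ry0 subrr.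
exists (s *: (y0 - d k y2)) => [|x mx].
  by rewrite linearZ /= linearB /= (d_d d_exact) subr0 -wy scalerBr sw ssw' subr0.
by have [c xs] := ms x mx; rewrite scalerA xs -scalerA ry scaler0.
Qed.

(** The argument of [ext_vanish_prime] for [0 -> N -> N -> N / r N -> 0]; the vanishing one degree
    higher for [N / r N] comes from [ext_vanish_module]. *)
Lemma ext_module_nakayama k (N : lmodType R) (r : R) (f : {linear N -> X k.+1}) :
    finitely_generated N -> m r -> (forall x : N, r *: x = 0 -> x = 0) ->
    (forall J, submodule J -> ext_vanish d k.+1 J) -> (forall x, d k.+1 (f x) = 0) ->
  exists h : {linear N -> X k}, forall x, f x = d k (h x).
Proof.
move=> Nfg mr rreg V fd; have Ssub := submodule_eq0 N.
have [s sC sS] := ext_fgen Rnoeth M1_fg Xinj e_exact d_exact k.+1 Nfg Ssub.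
have CB := nakayama mr (cocycle_submodule d k.+1 _) (coboundary_submodule d k.+1 _) sC sS.
have [f' [fl' fS' fd']||h [_ fh]] := CB _ (f : N -> X k.+1); last 1 first.
- by exists h => x; rewrite -[RHS]/((fun x => d k (h x)) x) -fh.
- have [F FE] := linear_exists fl'.
  have [x /= /rreg ->|w wE] := injective_factor (@Xinj k.+1) (a := r \*: idfun) (k := F).
    by rewrite linear0.
  have [_ [y ->]|x|w' [w'r w'E]] := @ext_vanish_module R X d Xinj d_exact k.+1 N
      (fun x => exists y, x = r *: y) (d k.+1 \o w) Nfg V.
  + by have /= := wE y; rewrite FE => <-; apply: fd'.
  + exact: (d_d d_exact).
  exists (w \- w').
    split=> [|x ->|x]; [exact: linearP | exact: linear0 |].
    by have /= e' := w'E x; rewrite /= linearB /= e' subrr.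
  suff -> : f' - r *: (w \- w' : N -> X k.+1) = 0.
    exact: (submodule0 (coboundary_submodule d k.+1 _)).
  apply/funext => x; have /= := wE x; rewrite FE => f'x.
  have -> : (f' - r *: (w \- w' : N -> X k.+1)) x = f' x - r *: (w x - w' x) by [].
  rewrite f'x scalerBr -!linearZ /= [w' _]w'r ?subr0 ?subrr //.
  by exists x.
- split=> [|x ->|]; [exact: linearP | exact: linear0 | exact: fd].
Qed.
End LocalVanishing.

(** * Splitting of the exact sequence *)

Lemma retraction_split (R : comNzRingType) (A B C : lmodType R)
    (f : {linear A -> B}) (g : {linear B -> C}) (rho : {linear B -> A}) :
  short_exact f g -> cancel f rho -> split_exact f g.
Proof.
move=> fg_exact frho; split=> //; case: fg_exact => finj fg gsurj.
have [t tE] := choice gsurj.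
pose s0 z := t z - f (rho (t z)).
have gf x : g (f x) = 0 by apply/fg; exists x.
have gs0 z : g (s0 z) = z by rewrite linearB /= gf subr0 -tE.
have rs0 z : rho (s0 z) = 0 by rewrite linearB /= frho subrr.
(* A lift killed by [rho] is unique, so [s0] does not depend on the choices in [t] and is linear. *)
have s0_unique y : rho y = 0 -> y = s0 (g y).
  move=> ry0; have [x yx] : exists x, y - s0 (g y) = f x.
    by apply/fg; rewrite linearB /= gs0 subrr.
  have x0 : x = 0 by rewrite -[x]frho -yx linearB /= ry0 rs0 subrr.
  by apply/eqP; rewrite -subr_eq0 yx x0 linear0.
have [|s sE] := @linear_exists R C B s0.
  move=> a u v; rewrite [RHS]s0_unique ?linearP /= ?gs0 //.
  by rewrite !rs0 scaler0 addr0.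
by exists s => z; rewrite sE gs0.
Qed.

(** Extending [e] along [f] to [h], the map [d 0 h] factors through [M2] as a cocycle [phi], the
    class of the extension. If [phi] bounds [h2], then [h - h2 g] takes values in the image of [e]
    and yields a retraction of [f]. *)
Lemma split_of_ext1 (R : comNzRingType) (M1 M M2 : lmodType R)
    (f : {linear M1 -> M}) (g : {linear M -> M2}) (X : nat -> lmodType R)
    (e : {linear M1 -> X 0%N}) (d : forall k, {linear X k -> X k.+1}) :
    (forall k, injective_module (X k)) -> injective e -> exact_at e (d 0%N) ->
    (forall k, exact_at (d k) (d k.+1)) -> short_exact f g ->
    (forall phi : {linear M2 -> X 1%N}, (forall x, d 1%N (phi x) = 0) ->
       exists h : {linear M2 -> X 0%N}, forall x, phi x = d 0%N (h x)) ->
  split_exact f g.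
Proof.
move=> Xinj einj ed dd fg_exact ext1; have [finj fg gsurj] := fg_exact.
have [h hE] := Xinj 0%N _ _ f e finj.
have [x|phi phiE] := injective_factor (Xinj 1%N) (a := g) (k := d 0%N \o h).
  by move=> /fg[y ->]; rewrite /= hE; apply/ed; exists y.
have [z|h2 h2E] := ext1 phi.
  by have [y ->] := gsurj z; rewrite -phiE /= (d_d dd).
have eimage x : exists y, h x - h2 (g x) = e y.
  by apply/ed; rewrite linearB /= -h2E -phiE subrr.
have [r rE] := choice eimage.
have [|rho rhoE] := @linear_exists R M M1 r.
  move=> a u v; apply: einj; rewrite linearP -!rE !linearP /=.
  by rewrite scalerBr scalerN addrACA.
apply: (@retraction_split _ _ _ _ f g rho) => // x.
have gf0 : g (f x) = 0 by apply/fg; exists x.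
by apply: einj; rewrite rhoE -rE hE gf0 linear0 subr0.
Qed.

Lemma torsion_free_cokernel (R : comNzRingType) (M M1 M2 : lmodType R) :
    torsion_free M -> isomorphic (tor M) (tor M1 * tor M2)%type ->
  torsion_free M2.
Proof.
move=> Mtf [h hbij] x xtor.
pose u : (tor M1 * tor M2)%type := (0, exist _ x xtor).
have torM0 (y : tor M) : y = 0 by apply: val_inj; apply: Mtf (valP y).
have : u = 0 by case: hbij => h' _ hK; rewrite -[u]hK [h' u]torM0 linear0.
by move=> /(congr1 snd)/(congr1 val).
Qed.

Theorem proposition3p4 (R : comNzRingType)
    (R_noetherian : noetherian R) (R_local : local_ring R)
    (R_dim1 : krull_dim_eq R 1)
    (M1 M M2 : lmodType R) (f : {linear M1 -> M}) (g : {linear M -> M2})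
    (M1_fg : finitely_generated M1) (M_fg : finitely_generated M)
    (M2_fg : finitely_generated M2)
    (zeta_exact : short_exact f g)
    (M_torsion_free : torsion_free M)
    (M1_findim : finite_injective_dimension M1)
    (tor_iso : isomorphic (tor M) (tor M1 * tor M2)%type) :
  split_exact f g.
Proof.
have [n [X [e [d [Xinj [einj ed] dd Xn]]]]] := M1_findim.
have [m [msub m1 mmax]] := local_ringP R_noetherian R_local.
have M2tf := torsion_free_cokernel M_torsion_free tor_iso.
have descent j := ext_vanish_descent R_noetherian msub m1 mmax M1_fg Xinj ed dd (j := j) Xn.
apply: (split_of_ext1 Xinj einj ed dd zeta_exact) => phi phid.
have [[s s0 ms]|[r [s [mr rreg nrs ms]]]] := socle_dichotomy R_noetherian msub m1 mmax R_dim1.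
  have V := descent 0%N (fun k _ => ext_vanish_socle0 mmax Xinj dd s0 ms).
  (* Depth 0: Ext^1 already vanishes. The empty predicate imposes no condition on [h]. *)
  have [//|h [_ hE]] := ext_vanish_module (S := fun=> False) Xinj dd M2_fg (V 0%N isT) _ phid.
  by exists h.
(* Depth 1: the descent stops at [k = 1], that is, at Ext^2. *)
have V1 k : (1 <= k)%N -> (forall J, submodule J -> ext_vanish d k.+1 J) ->
    ext_vanish d k m.
  by case: k => // k _; apply: (ext_vanish_socle1 mmax Xinj dd mr rreg nrs ms).
apply: (ext_module_nakayama R_noetherian msub m1 mmax M1_fg Xinj ed dd (r := r)) => //.
  (* An element of [M2] killed by the non-zerodivisor [r] is torsion. *)
  move=> x rx; apply: M2tf; apply/asboolP; exists r; split=> //.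
  move=> a b; rewrite mulrC [r * b]mulrC => ab; apply/eqP; rewrite -subr_eq0; apply/eqP.
  by apply: rreg; rewrite mulrBl ab subrr.
exact: (descent 1%N V1 1%N).
Qed.
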